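(* Let $I$ be a monomial ideal of $R=K[x_1,\ldots,x_n]$ of height $\geq 2$ and let $\mathrm{v}(I)$ be its $\mathrm{v}$-number. Then (i) $\mathrm{Ass}(I)=\mathrm{Ass}(\mathrm{sgn}(I))$. (ii) $\mathrm{v}(\mathrm{sgn}(I))\leq \mathrm{v}(I)$. (iii) $I$ is unmixed if and only if $\mathrm{sgn}(I)$ is unmixed.
   Context: $K$ is a field and $R=K[x_1,\ldots,x_n]$ is a polynomial ring with the standard grading. For $a=(a_1,\ldots,a_n)\in\mathbb{N}^n$ (with $0\in\mathbb N$), $x^a:=x_1^{a_1}\cdots x_n^{a_n}$. A monomial ideal $I$ of $R$ has a unique finite minimal set of monomial generators $G(I)=\{x^{v_1},\ldots,x^{v_q}\}$. The incidence matrix of $I$ is the $n\times q$ matrix $A$ with columns $v_1,\ldots,v_q$. Signature: for each row $c=(c_1,\ldots,c_q)$ of $A$, list its distinct entries in ascending order $m_0<m_1<\cdots<m_r$, let $j_i$ be the index with $c_i=m_{j_i}$, and put $\mathrm{sgn}(c)=(j_1,\ldots,j_q)$. The matrix $\mathrm{sgn}(A)$ has rows $\mathrm{sgn}(c)$, with $c$ running over the rows of $A$. The signature $\mathrm{sgn}(I)$ is the ideal of $R$ generated by the monomials $x^w$ with $w$ a column of $\mathrm{sgn}(A)$. For a monomial ideal $I$, $(I\colon x^a):=\{g\in R\mid gx^a\in I\}$. A prime ideal $\mathfrak p$ of $R$ is an associated prime of $I$ if $\mathfrak p=(I\colon x^a)$ for some monomial $x^a$; $\mathrm{Ass}(I)$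 is the set of associated primes of $I$. The $\mathrm v$-number of $I$ is $$\mathrm{v}(I):=\min\{d\geq 0\mid \exists\, x^a \text{ of degree } d \text{ and } \mathfrak p\in\mathrm{Ass}(I)\text{ with }(I\colon x^a)=\mathfrak p\}.$$ $I$ is unmixed if $\mathrm{ht}(I)=\mathrm{ht}(\mathfrak p)$ for all $\mathfrak p\in\mathrm{Ass}(I)$, where $\mathrm{ht}$ denotes height. *)

(* Defs.v *)
From mathcomp Require Import all_boot all_order all_algebra.
From mathcomp Require Import finmap mpoly.
From mathcomp Require Import boolp classical_sets.
From mathcomp Require Import constructive_ereal.

Set Implicit Arguments.
Unset Strict Implicit.
Unset Printing Implicit Defensive.

Local Open Scope ring_scope.
Local Open Scope classical_set_scope.

Section Ideals.
Variable R : comNzRingType.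
Implicit Types I p : set R.

(* Unlike the predicate idealr_closed, this one also holds for the unit
   ideal. *)
Definition is_ideal I :=
  I 0 /\ forall a u v : R, I u -> I v -> I (a * u + v).

(* idealr_closed already requires 1 \notin p. *)
Definition is_prime p :=
  idealr_closed (fun x : R => x \in p) /\
  prime_idealr_closed (fun x : R => x \in p).

(* c 0, ..., c k is a strictly increasing chain of primes with top p. *)
Definition prime_chain p (k : nat) (c : nat -> set R) :=
  [/\ forall i, (i <= k)%N -> is_prime (c i),
      forall i, (i < k)%N -> c i `<` c i.+1 & c k = p].

(* Heights and v-numbers take values in N U {+oo}, seen inside \bar int. *)
Definition prime_height p : \bar int :=
  supremum -oo%E [set k%:Z%:E | k in [set k | exists c, prime_chain p k c]].

(* The unit ideal, which lies in no prime, gets height +oo. *)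
Definition ht I : \bar int :=
  infimum +oo%E [set prime_height p | p in [set p | is_prime p /\ I `<=` p]].

End Ideals.

Section MonomialIdeals.
Variables (K : fieldType) (n : nat).
Implicit Types I p : set {mpoly K[n]}.

Definition mideal (S : set 'X_{1..n}) : set {mpoly K[n]} :=
  smallest (@is_ideal {mpoly K[n]}) [set 'X_[m] | m in S].

Definition monomial_ideal I := exists S : set 'X_{1..n}, I = mideal S.

Definition is_mingens I (G : {fset 'X_{1..n}}) :=
  mideal [set` G] = I /\
  forall H : set 'X_{1..n}, H `<` [set` G] -> mideal H <> I.

(* The value fset0 is only taken when I is not a monomial ideal or I = 0:
   a monomial ideal has exactly one finite minimal set of monomial
   generators (Dickson). *)
Definition mingens I : {fset 'X_{1..n}} := xget fset0 (is_mingens I).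

(* The columns of the incidence matrix, in the order in which the finite set
   mingens I is enumerated. *)
Definition incidence I : 'M[nat]_(n, #|` mingens I|) :=
  \matrix_(i, j) nth 0%MM (enum_fset (mingens I)) j i.

Definition sgn_mx q (A : 'M[nat]_(n, q)) : 'M[nat]_(n, q) :=
  \matrix_(i, j) index (A i j) (sort leq (undup [seq A i k | k : 'I_q])).

Definition col_mnm q (A : 'M[nat]_(n, q)) (j : 'I_q) : 'X_{1..n} :=
  [multinom A i j | i < n].

Definition signature I : set {mpoly K[n]} :=
  mideal (range (col_mnm (sgn_mx (incidence I)))).

Definition colon I (a : 'X_{1..n}) : set {mpoly K[n]} :=
  [set g | I (g * 'X_[a])].

Definition Ass I : set (set {mpoly K[n]}) :=
  [set p | is_prime p /\ exists a, p = colon I a].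

(* +oo when Ass I is empty, that is, for the unit ideal. *)
Definition vnumber I : \bar int :=
  infimum +oo%E [set (mdeg a)%:Z%:E |
             a in [set a | exists2 p, Ass I p & colon I a = p]].

Definition unmixed I := forall p, Ass I p -> ht I = ht p.

End MonomialIdeals.

(* Main.v *)
From HB Require Import structures.
Require Import Defs.
From mathcomp Require Import all_boot all_order all_algebra.
From mathcomp Require Import finmap mpoly.
From mathcomp Require Import boolp classical_sets.
From mathcomp Require Import constructive_ereal.

Set Implicit Arguments.
Unset Strict Implicit.
Unset Printing Implicit Defensive.

Import Order.TTheory GRing.Theory Num.Theory.
Local Open Scope ring_scope.
Local Open Scope classical_set_scope.

(** Let x^(v_1), ..., x^(v_q) be the generators of [I], and let w_k be obtained
    from v_k by replacing each entry by its rank in its row, i.e. by the number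
    of distinct smaller entries of that row; the w_k generate J, the signature
    of [I]. Height at least 2 forbids a common variable factor of the
    generators, because an ideal contained in (x_i) has height at most 1
    ([ht_ge2_coprime]). So every row contains 0, and 0 has rank 0.

    A quotient (I : x^a) that is prime is generated by variables, hence it is
    known as soon as one knows, row by row, which entries are at most a_i and
    which are at most a_i + 1. [colon_transfer] makes this precise: if the
    ranks of all the entries that are at most a_i (resp. a_i + 1) are at most
    b_i (resp. b_i + 1), with an equivalence in the first case, then
    (J : x^b) = (I : x^a); and the roles of [I] and J can be exchanged.

    Since ranks increase strictly with the entries and leave no gap, such a b_i
    exists for every a_i, with b_i <= a_i ([rank_lower]), and such an a_i exists
    for every b_i ([rank_raise]). The two existence statements give
    Ass I = Ass J, and the inequality b_i <= a_i gives v(J) <= v(I).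

    A prime contains a monomial ideal exactly when it contains a variable of each
    generator, and the same variables occur in v_k and w_k. So [I] and J lie in
    the same primes and have the same height; with the equality of the
    associated primes this settles unmixedness. *)

(** * Ranks in a list of natural numbers *)

(** Counting the smaller values, rather than searching in the sorted list, makes
    every comparison of ranks an inclusion of the sets counted. *)
Definition rank (s : seq nat) (v : nat) := count (fun u => u < v)%N (undup s).

Lemma index_sort_undup s v : v \in s ->
  index v (sort leq (undup s)) = rank s v.
Proof.
move=> vs; set L := sort leq (undup s).
have vL : v \in L by rewrite mem_sort mem_undup.
have sL : sorted <%O L.
  have := sort_sorted leq_total (undup s); rewrite -/L => sle.
  by rewrite lt_sorted_uniq_le sort_uniq undup_uniq.
rewrite /rank -(permP (permEl (perm_sort leq (undup s)))) -/L.
by rewrite -[X in count (fun u => u < X)%N](nth_index 0%N vL)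
  (count_lt_nth _ sL) // index_mem.
Qed.

Lemma leq_rank s v v' : (v <= v')%N -> (rank s v <= rank s v')%N.
Proof. by move=> le_v; apply: sub_count => u /= /leq_trans; apply. Qed.

Lemma rank_lt_count s v t : v \in s -> (v <= t)%N ->
  (rank s v < count (fun u => u <= t)%N (undup s))%N.
Proof.
rewrite -mem_undup => vs le_vt.
have := count_lt_le_mem v (undup s); rewrite vs => /leq_trans; apply.
by apply: sub_count => u /= /leq_trans; apply.
Qed.

Lemma count_leq_max s t : (count (fun u => u <= t)%N (undup s) <= t.+1)%N.
Proof.
rewrite -size_filter -[t.+1](size_iota 0); apply: uniq_leq_size.
  by rewrite filter_uniq // undup_uniq.
by move=> u; rewrite mem_filter mem_iota add0n ltnS => /andP[].
Qed.

(** If [c] distinct entries are at most [t], then [j = c - 1] works: an entry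
    is at most [t] exactly when fewer than [c] entries are smaller than it, and
    an entry that is at most [t + 1] has at most [c] smaller ones. The
    bound [j <= t] holds because at most [t + 1] distinct naturals are at most
    [t]; 0 in the list makes [c] positive. *)
Lemma rank_lower s t : 0%N \in s ->
  exists2 j, (j <= t)%N & forall v, v \in s ->
    ((v <= t)%N = (rank s v <= j)%N) /\
    ((v <= t.+1)%N -> (rank s v <= j.+1)%N).
Proof.
move=> s0; set c := count (fun u => u <= t)%N (undup s).
have c_gt0 : (0 < c)%N by rewrite (leq_trans _ (rank_lt_count s0 (leq0n t))).
exists c.-1; first by rewrite -ltnS prednK // count_leq_max.
move=> v vs; split; last first.
  by rewrite prednK // => le_vt; apply: sub_count => u /= lt_uv;
    exact: leq_trans lt_uv le_vt.
rewrite -[(rank s v <= _)%N]ltnS prednK //; apply/idP/idP => [|].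
  exact: rank_lt_count.
apply: contraTT; rewrite -!ltnNge ltnS => lt_tv.
by apply: sub_count => u /= /leq_ltn_trans; apply.
Qed.

(** If some entry [u] has rank [j + 1], then [t = u - 1] works, since the entries
    of rank at most [j] are those smaller than [u]. Otherwise the largest entry
    of rank at most [j] works, because rank [j + 1] does not occur. *)
Lemma rank_raise s j : 0%N \in s ->
  exists t, forall v, v \in s ->
    ((rank s v <= j)%N = (v <= t)%N) /\
    ((rank s v <= j.+1)%N -> (v <= t.+1)%N).
Proof.
move=> s0; have [/hasP[u us /eqP ru]|/hasPn no_u] :=
  boolP (has (fun u => rank s u == j.+1) s).
  have rank_le v : (rank s v <= j)%N -> (v < u)%N.
    by move=> rv; rewrite ltnNge; apply/negP => /(leq_rank s);
       rewrite ru => /leq_trans/(_ rv); rewrite ltnn.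
  have rank_ge v : v \in s -> (v < u)%N -> (rank s v <= j)%N.
    move=> vs lt_vu; rewrite -ltnS -ru /(rank s u).
    apply: leq_trans (rank_lt_count vs (leqnn v)) _.
    by apply: sub_count => w /= /leq_ltn_trans; apply.
  have u_gt0 : (0 < u)%N.
    rewrite lt0n; apply: contra_eq_neq ru => ->.
    by rewrite /rank (eq_count (a2 := pred0)) ?count_pred0.
  exists u.-1 => v vs; split.
    rewrite -[in RHS]ltnS prednK //.
    by apply/idP/idP => [/rank_le|/(rank_ge v vs)].
  rewrite prednK // => rv; rewrite leqNgt; apply/negP => lt_uv.
  suff : (j.+1 < rank s v)%N by rewrite ltnNge rv.
  rewrite -ru; apply: leq_trans (rank_lt_count us (leqnn u)) _.
  by apply: sub_count => w /= /leq_ltn_trans; apply.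
have [u us [ru umax]] : exists2 u, u \in s & (rank s u <= j)%N /\
    forall v, v \in s -> (rank s v <= j)%N -> (v <= u)%N.
  have r0 : (0 \in s) && (rank s 0 <= j)%N.
    by rewrite s0 /rank (eq_count (a2 := pred0)) ?count_pred0.
  have bnd v : (v \in s) && (rank s v <= j)%N -> (v <= \max_(x <- s) x)%N.
    by case/andP => vs _; apply: leq_bigmax_seq.
  case: (ex_maxnP (ex_intro _ 0%N r0) bnd) => u /andP[us ru] umax.
  by exists u => //; split=> // v vs rv; apply: umax; rewrite vs.
exists u => v vs.
have eq_v : (rank s v <= j)%N = (v <= u)%N.
  apply/idP/idP => [/(umax v vs)//|/(leq_rank s) /leq_trans]; exact.
split=> //; rewrite leq_eqVlt ltnS (negPf (no_u v vs)) /= eq_v.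
exact: leqW.
Qed.

(** * Primes and monomial ideals *)

Lemma ideal_mulr (R : comNzRingType) (p : set R) a u :
  is_ideal p -> p u -> p (a * u).
Proof. by case=> p0 pD pu; rewrite -[a * u]addr0; apply: pD. Qed.

Lemma ideal_sum (R : comNzRingType) (T : eqType) (p : set R) (r : seq T)
    (F : T -> R) :
  is_ideal p -> (forall x, x \in r -> p (F x)) -> p (\sum_(x <- r) F x).
Proof.
move=> [p0 pD] pF; rewrite big_seq; apply: big_rec => // x u xr pu.
by rewrite -[F x]mul1r; apply: pD => //; apply: pF.
Qed.

Lemma prime_is_ideal (R : comNzRingType) (p : set R) : is_prime p -> is_ideal p.
Proof.
case=> [[p0 _ pD] _]; split; first exact: set_mem p0.
by move=> a u v /mem_set pu /mem_set pv; apply: set_mem (pD a u v pu pv).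
Qed.

Lemma primeP (R : comNzRingType) (p : set R) : is_ideal p ->
  is_prime p <-> ~ p 1 /\ forall u v, p (u * v) -> p u \/ p v.
Proof.
move=> [p0 pD]; split.
  case=> [[_ /negP p1 _] pM]; split; first by move/mem_set.
  by move=> u v /mem_set/pM/orP[] /set_mem; [left|right].
case=> p1 pM; split; first split.
- exact: mem_set.
- by apply/negP => /set_mem.
- by move=> a u v /set_mem pu /set_mem pv; apply/mem_set/pD.
- by move=> u v /set_mem/pM[] /mem_set uv; apply/orP; [left|right].
Qed.

Section Monomials.
Variables (K : fieldType) (n : nat).
Implicit Types (S : set 'X_{1..n}) (m a b : 'X_{1..n}) (f : {mpoly K[n]}).

Lemma ideal_msupp (p : set {mpoly K[n]}) f : is_ideal p ->
  (forall m, m \in msupp f -> p 'X_[m]) -> p f.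
Proof.
move=> idp pX; rewrite (mpolyE f); apply: ideal_sum => // m /pX.
by rewrite -mul_mpolyC; apply: ideal_mulr.
Qed.

Lemma lep_is_ideal S : is_ideal [set f : {mpoly K[n]} |
  forall m, m \in msupp f -> exists2 s, S s & (s <= m)%MM].
Proof.
split=> [m|a u v Su Sv m]; first by rewrite msupp0.
move/msuppD_le; rewrite mem_cat => /orP[|/Sv//].
move/msuppM_le => /allpairsP[[m1 m2] /= [_ /Su[s Ss le_s] ->]].
by exists s => //; apply: lepm_trans le_s (lem_addl _ _).
Qed.

(** The right-hand side is an ideal because every monomial of [a * u + v] is a
    multiple of a monomial of [u] or is a monomial of [v]. It reduces all
    questions about monomial ideals to divisibility of exponents. *)
Lemma midealP S f : (mideal S : set {mpoly K[n]}) f <->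
  forall m, m \in msupp f -> exists2 s, S s & (s <= m)%MM.
Proof.
split.
  apply: (smallest_sub (lep_is_ideal S)) => _ [s Ss <-] m.
  by rewrite msuppX inE => /eqP->; exists s => //; apply: lepm_refl.
move=> Sf J [idJ SJ]; apply: ideal_msupp => // m /Sf[s Ss le_sm].
by rewrite -(submK le_sm) mpolyXD; apply: ideal_mulr => //; apply: SJ; exists s.
Qed.

Lemma mideal_mnm S m : (mideal S : set {mpoly K[n]}) 'X_[m] <->
  exists2 s, S s & (s <= m)%MM.
Proof.
rewrite midealP; split=> [|Sm m']; first by apply; rewrite msuppX inE.
by rewrite msuppX inE => /eqP->.
Qed.

Lemma colonP S a f : colon (mideal S) a f <->
  forall m, m \in msupp f -> exists2 s, S s & (s <= m + a)%MM.
Proof.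
rewrite /colon /= midealP; split=> Sf m.
  move=> mf; apply: Sf; rewrite (perm_mem (msuppMX _ _)) addmC.
  exact: map_f.
by rewrite (perm_mem (msuppMX _ _)) => /mapP[m' /Sf + ->]; rewrite addmC.
Qed.

Lemma colon_mnm S a m : (colon (mideal S) a : set {mpoly K[n]}) 'X_[m] <->
  exists2 s, S s & (s <= m + a)%MM.
Proof.
rewrite colonP; split=> [|Sm m']; first by apply; rewrite msuppX inE.
by rewrite msuppX inE => /eqP->.
Qed.

Lemma prime_mnm (p : set {mpoly K[n]}) m : is_prime p ->
  p 'X_[m] <-> exists2 i, m i != 0%N & p 'X_i.
Proof.
move=> prp; have idp := prime_is_ideal prp.
have [p1 pM] := (primeP idp).1 prp; split; last first.
  case=> i mi pXi; have le_im : (U_(i) <= m)%MM.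
    apply/mnm_lepP => j; rewrite mnm1E; case: eqP => // <-.
    by rewrite lt0n.
  by rewrite -(submK le_im) mpolyXD; apply: ideal_mulr.
move=> pm; suff [i _ [mi pXi]] : exists2 i, true & m i != 0%N /\ p 'X_i.
  by exists i.
move: pm; rewrite mpolyXE_id.
elim/big_rec: _ => [//|i x _ IH /pM[|/IH//]].
case: (m i =P 0%N) => [->|/eqP mi]; first by rewrite expr0.
move=> pXi; exists i => //; split=> //.
by elim: (m i) pXi => [//|k IHk]; rewrite exprS => /pM[].
Qed.

Lemma prime_mideal (p : set {mpoly K[n]}) S : is_prime p ->
  mideal S `<=` p <-> forall s, S s -> exists2 i, s i != 0%N & p 'X_i.
Proof.
move=> prp; split=> [Sp s Ss|Sp].
  by rewrite -prime_mnm //; apply: Sp; apply/mideal_mnm; exists s => //;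
     apply: lepm_refl.
apply: smallest_sub; first exact: prime_is_ideal.
by move=> _ [s Ss <-]; rewrite /= prime_mnm //; apply: Sp.
Qed.

(** Both ideals are monomial, so only monomials need to be compared. If [w k]
    divides [m + b], erase from [v k] the coordinates where [m] vanishes: what
    is left lies in the prime colon ideal, hence involves one of its variables,
    and that variable also divides [m]. Conversely, a monomial of the prime
    involves one of its variables x_i, so some [v k] divides [U_(i) + a], and
    [w k] then divides [U_(i) + b], which divides [m + b]. *)
Lemma colon_transfer (T : Type) (v w : T -> 'X_{1..n}) a b :
  is_prime (colon (mideal (range v)) a : set {mpoly K[n]}) ->
  (forall k i, (v k i <= a i)%N = (w k i <= b i)%N) ->
  (forall k i, (v k i <= (a i).+1)%N -> (w k i <= (b i).+1)%N) ->
  colon (mideal (range w)) b = colon (mideal (range v)) a :> set {mpoly K[n]}.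
Proof.
move=> prp eq_vw step.
suff eqX m : (exists2 s, range w s & (s <= m + b)%MM) <->
             (exists2 s, range v s & (s <= m + a)%MM).
  by apply/seteqP; split=> f /colonP Sf; apply/colonP => m /Sf/eqX.
split.
  move=> [_ [k _ <-] /mnm_lepP le_w].
  pose m' := [multinom if m i == 0%N then 0%N else v k i | i < n].
  have : (colon (mideal (range v)) a : set {mpoly K[n]}) 'X_[m'].
    apply/colon_mnm; exists (v k); first by exists k.
    apply/mnm_lepP => i; rewrite mnmDE mnmE; case: eqP => [mi|_].
      by rewrite add0n eq_vw; have := le_w i; rewrite mnmDE mi.
    exact: leq_addr.
  rewrite prime_mnm // => -[i]; rewrite mnmE => m'i pXi.
  apply/colon_mnm; apply/(prime_mnm _ prp); exists i => //.
  by apply: contraNneq m'i => ->.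
move/colon_mnm/(prime_mnm _ prp) => [i mi /colon_mnm[_ [k _ <-] /mnm_lepP le_v]].
exists (w k); first by exists k.
apply/mnm_lepP => j; rewrite mnmDE; have := le_v j; rewrite mnmDE mnm1E.
case: eqP => [<-|_]; rewrite ?add1n ?add0n.
  by move/step/leq_trans; apply; rewrite -add1n leq_add2r lt0n.
by rewrite eq_vw => /leq_trans; apply; rewrite leq_addl.
Qed.

End Monomials.

(** Dickson's lemma, by induction on the number [k] of coordinates compared. In
    the step, a finite [s0] that works for the first [k] coordinates also works
    for the exponents whose next coordinate is at least the maximum [N] of that
    coordinate over [s0]; each of the [N] remaining values of the coordinate
    gives a slice to which the induction hypothesis applies. *)
Lemma dickson n (S : set 'X_{1..n}) : exists2 s : seq 'X_{1..n},
  [set` s] `<=` S & forall m, S m -> exists2 t, t \in s & (t <= m)%MM.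
Proof.
suff /(_ n S (leqnn n))[s sS sP] : forall k (S : set 'X_{1..n}), (k <= n)%N ->
    exists2 s : seq 'X_{1..n}, [set` s] `<=` S &
    forall m, S m -> exists2 t, t \in s &
      forall i : 'I_n, (i < k)%N -> (t i <= m i)%N.
  exists s => // m /sP[t ts le_tm]; exists t => //.
  by apply/mnm_lepP => i; apply: le_tm.
elim=> [|k IHk] {}S.
  move=> _; have [[m Sm]|S0] := pselect (exists m, S m).
    by exists [:: m] => [t|m' _]; [rewrite /= inE => /eqP->|exists m; rewrite ?inE].
  by exists [::] => [t|m Sm]; [rewrite /= inE|case: S0; exists m].
move=> lt_kn; have le_kn := ltnW lt_kn; pose o := Ordinal lt_kn.
have [s0 s0S s0P] := IHk S le_kn.
pose N := (\max_(t <- s0) t o)%N.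
have slice j : exists s : seq 'X_{1..n}, [set` s] `<=` S `&` [set m | m o = j] /\
    forall m, S m -> m o = j -> exists2 t, t \in s &
      forall i : 'I_n, (i < k)%N -> (t i <= m i)%N.
  have [s sS sP] := IHk (S `&` [set m | m o = j]) le_kn.
  by exists s; split=> // m Sm mj; apply: sP.
have [s_ s_P] := choice slice.
exists (s0 ++ flatten [seq s_ j | j <- iota 0 N]).
  move=> t /=; rewrite mem_cat => /orP[/s0S//|/flattenP[_ /mapP[j _ ->]]].
  by move=> /(s_P j).1[].
have ext t m : (forall i : 'I_n, (i < k)%N -> (t i <= m i)%N) ->
    (t o <= m o)%N -> forall i : 'I_n, (i < k.+1)%N -> (t i <= m i)%N.
  move=> lt_t le_o i; rewrite ltnS leq_eqVlt => /orP[/eqP ik|/lt_t//].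
  by rewrite (_ : i = o) //; apply: val_inj.
move=> m Sm; have [le_Nm|lt_mN] := leqP N (m o).
  have [t ts le_t] := s0P m Sm; exists t; first by rewrite mem_cat ts.
  by apply: ext => //; apply: leq_trans le_Nm; apply: leq_bigmax_seq.
have [t ts le_t] := (s_P (m o)).2 m Sm erefl.
exists t; last by apply: ext => //; have [_ ->] := (s_P (m o)).1 t ts.
rewrite mem_cat; apply/orP; right; apply/flattenP; exists (s_ (m o)) => //.
by apply: map_f; rewrite mem_iota.
Qed.

(** A finite generating set of least cardinality is minimal for inclusion. *)
Lemma mingensP (K : fieldType) n (I : set {mpoly K[n]}) :
  monomial_ideal I -> is_mingens I (mingens I).
Proof.
move=> [S defI].
suff [G GP] : exists G, is_mingens I G by rewrite /mingens; case: xgetP => // /(_ G).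
pose gen d := `[< exists2 G : {fset 'X_{1..n}}, #|` G| = d & mideal [set` G] = I >].
have ex_gen : exists d, gen d.
  have [s sS sP] := dickson S.
  have memE t : t \in seq_fset tt s <-> t \in s by rewrite seq_fsetE.
  exists #|` seq_fset tt s|; apply/asboolP; exists (seq_fset tt s) => //.
  rewrite defI; apply/seteqP; split=> f; rewrite !midealP => Sf m /Sf[t].
    by move=> /memE/sS St le_t; exists t.
  move=> St le_t; have [t' ts le_t'] := sP t St.
  by exists t'; [apply/memE|apply: lepm_trans le_t].
case: (ex_minnP ex_gen) => d /asboolP[G cardG genG] min_d.
exists G; split=> // H [HG nHG] genH; apply: nHG.
pose H' : {fset 'X_{1..n}} := [fset m in G | `[< H m >]]%fset.
have defH : [set` H'] = H.
  apply/seteqP; split=> m /=; rewrite !inE.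
    by case/andP=> _ /asboolP.
  by move=> Hm; rewrite (HG m Hm); apply/asboolP.
have H'G : (H' `<=` G)%fset by apply/fsubsetP => m; rewrite !inE => /andP[].
have : (d <= #|` H'|)%N by apply: min_d; apply/asboolP; exists H' => //; rewrite defH.
rewrite -cardG => le_card.
have /eqP eqH : H' == G by rewrite eqEfcard H'G.
by rewrite -defH eqH.
Qed.

(** * Heights *)

(** A set without a finite lower bound has infimum -oo; otherwise its least
    element exists because the integers above a bound are well-ordered. *)
Lemma infimums_bar_int (A : set (\bar int)) : A !=set0 -> infimums A !=set0.
Proof.
move=> [x0 Ax0].
have [[m mA]|no_lb] := pselect (exists m : int, lbound A m%:E); last first.
  exists -oo%E; split=> [x _|[m|/=|//] lbm]; first exact: leNye.
  - by case: no_lb; exists m.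
  - by case: no_lb; exists 0 => x /lbm; apply: le_trans; apply: leey.
have [[k Ak]|no_fin] := pselect (exists k : int, A k%:E); last first.
  exists +oo%E; split=> [[k| |] Ax|x _]; last exact: leey.
  - by case: no_fin; exists k.
  - by [].
  - by have := mA _ Ax.
have val_ge k' : A k'%:E -> k' = m + `|k' - m|%N%:Z.
  by move=> /mA; rewrite lee_fin => le_mk;
    rewrite gez0_abs ?subr_ge0 // [RHS]addrC subrK.
pose P d := `[< A (m + d%:Z)%:E >].
have exP : exists d, P d by exists `|k - m|%N; apply/asboolP; rewrite -val_ge.
case: (ex_minnP exP) => d /asboolP Ad min_d.
exists (m + d%:Z)%:E; split=> [[k'| |] Ax|y]; last exact.
- rewrite lee_fin (val_ge _ Ax) lerD2l lez_nat; apply: min_d.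
  by apply/asboolP; rewrite -val_ge.
- exact: leey.
- by have := mA _ Ax.
Qed.

Lemma infimum_le (A : set (\bar int)) x : A x -> (infimum +oo%E A <= x)%E.
Proof.
move=> Ax; apply: le_infimum_Nmem => //.
by apply: infimums_bar_int; exists x.
Qed.

Lemma le_infimum (A : set (\bar int)) y :
  lbound A y -> (y <= infimum +oo%E A)%E.
Proof.
move=> lby; rewrite /infimum; case: eqP => [_|_]; first exact: leey.
by case: xgetP => [x -> [_]|_]; [apply|apply: leey].
Qed.

Lemma supremum_le (A : set (\bar int)) y :
  ubound A y -> (supremum -oo%E A <= y)%E.
Proof.
move=> uby; rewrite /supremum; case: eqP => [_|_]; first exact: leNye.
by case: xgetP => [x -> [_]|_]; [apply|apply: leNye].
Qed.

Lemma prime_kernel (A : comNzRingType) (B : idomainType)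
  (h : {rmorphism A -> B}) : is_prime [set f | h f = 0].
Proof.
apply/primeP; last split.
- split=> [|a u v /= hu hv]; first exact: rmorph0.
  by rewrite rmorphD rmorphM hu hv mulr0 addr0.
- by move/eqP; rewrite /= rmorph1 oner_eq0.
- by move=> u v /= /eqP; rewrite rmorphM mulf_eq0 => /orP[]/eqP; [left|right].
Qed.

Section VariableIdeal.
Variables (K : fieldType) (n : nat) (i : 'I_n).

(** The ideal (x_i) is handled as the kernel of the substitution x_i := 0, which
    makes its primality immediate. *)
Definition kill_var : {mpoly K[n]} -> {mpoly K[n]} :=
  comp_mpoly [tuple (if j == i then 0 else 'X_j : {mpoly K[n]}) | j < n].
HB.instance Definition _ := GRing.RMorphism.on kill_var.

Lemma kill_var_mnm m : kill_var 'X_[m] = if m i == 0%N then 'X_[m] else 0.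
Proof.
rewrite /kill_var comp_mpolyX.
rewrite (eq_bigr (fun j => (if j == i then 0 else 'X_j) ^+ m j)); last first.
  by move=> j _; rewrite tnth_mktuple.
case: eqP => mi; last first.
  by rewrite (bigD1 i) //= eqxx expr0n; case: eqP mi => //; rewrite mul0r.
rewrite [RHS]mpolyXE_id; apply: eq_bigr => j _; case: eqP => // ->.
by rewrite mi !expr0.
Qed.

Lemma kill_var_dvd f : kill_var f = 0 -> exists g, f = g * 'X_i.
Proof.
move=> f0; rewrite -[f]subr0 -f0 {f0}.
suff id : is_ideal [set f : {mpoly K[n]} | exists g, f = g * 'X_i].
  have -> : kill_var f = \sum_(m <- msupp f) f@_m *: kill_var 'X_[m].
    rewrite {1}(mpolyE f) /kill_var linear_sum.
    by apply: eq_bigr => m _; rewrite linearZ.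
  rewrite {1}(mpolyE f) -sumrB.
  apply: (ideal_sum (p := [set f : {mpoly K[n]} | exists g, f = g * 'X_i]) id).
  move=> m _; rewrite -scalerBr -mul_mpolyC kill_var_mnm; apply: ideal_mulr => //.
  case: eqP => [_|/eqP mi]; first by exists 0; rewrite subrr mul0r.
  have le_im : (U_(i) <= m)%MM.
    by apply/mnm_lepP => j; rewrite mnm1E; case: eqP => // <-; rewrite lt0n.
  by exists 'X_[m - U_(i)]; rewrite subr0 -mpolyXD submK.
split; first by exists 0; rewrite mul0r.
by move=> a u v [g ->] [h ->]; exists (a * g + h); rewrite mulrDl mulrA.
Qed.

(** The case of Krull's principal ideal theorem that is needed. A prime [q]
    strictly below (x_i) does not contain x_i, so with f = g x_i it contains [g]
    too; since [g] has smaller degree than [f], descent leaves only f = 0. *)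
Lemma prime_sub_variable (q : set {mpoly K[n]}) :
  is_prime q -> q `<` [set f | kill_var f = 0] -> q `<=` [set 0].
Proof.
move=> prq [q_sub q_ne]; have [_ qM] := (primeP (prime_is_ideal prq)).1 prq.
have qX : ~ q 'X_i.
  move=> qX; apply: q_ne => f /kill_var_dvd[g ->].
  exact: ideal_mulr (prime_is_ideal prq) qX.
move=> f; have [d] := ubnP (msize f).
elim: d f => // d IHd f le_fd qf /=.
have [g def_f] := kill_var_dvd (q_sub _ qf).
have [g0|g_neq0] := eqVneq g 0; first by rewrite def_f g0 mul0r.
have := qf; rewrite def_f => /qM[qg|//].
rewrite (IHd g) ?mul0r //.
move: le_fd; rewrite def_f msizeM // ?msizeX ?mdeg1 ?addn2 //.
by rewrite -msize_poly_eq0 msizeX.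
Qed.

(** In a chain c_0 < ... < c_(k+2) = (x_i) the ideal c_(k+1) would be zero, with
    no room below it for c_k. *)
Lemma prime_height_variable :
  (prime_height [set f : {mpoly K[n]} | kill_var f = 0%R] <= 1%:Z%:E)%E.
Proof.
apply: supremum_le => _ [k [c [c_prime c_lt c_top]] <-].
rewrite lee_fin lez_nat; case: k c_prime c_lt c_top => [//|[//|k]] c_prime c_lt c_top.
have c0 : c k.+1 `<=` [set 0].
  by apply: prime_sub_variable; [apply: c_prime|rewrite -c_top; apply: c_lt].
have [_ nsub] := c_lt k (ltnW (leqnn _)); case: nsub => f /c0->.
have ck : is_prime (c k) by apply: c_prime; rewrite -addn2 leq_addr.
by have [] := prime_is_ideal ck.
Qed.

End VariableIdeal.

Lemma ht_ge2_coprime (K : fieldType) n (S : set 'X_{1..n}) (i : 'I_n) :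
  (2%:Z%:E <= ht (mideal S : set {mpoly K[n]}))%E ->
  exists2 s, S s & s i = 0%N.
Proof.
move=> ht2; apply: contrapT => noS.
suff : (ht (mideal S : set {mpoly K[n]}) <= 1%:Z%:E)%E.
  by move=> /(le_trans ht2).
apply: le_trans (prime_height_variable K i); apply: infimum_le.
eexists; last reflexivity; have prk := prime_kernel (@kill_var K n i).
split=> //; apply/prime_mideal => // s Ss; exists i.
  by apply/eqP => si; apply: noS; exists s.
by rewrite /= kill_var_mnm mnm1E eqxx.
Qed.

(** * The signature *)

Section Signature.
Variables (K : fieldType) (n q : nat) (A : 'M[nat]_(n, q)).
Hypothesis A0 : forall i, exists j, A i j = 0%N.

Let v := col_mnm A.
Let w := col_mnm (sgn_mx A).
Let I : set {mpoly K[n]} := mideal (range v).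
Let J : set {mpoly K[n]} := mideal (range w).
Let row i := [seq A i k | k : 'I_q].

Let vE k i : v k i = A i k. Proof. exact: mnmE. Qed.
Let row_mem i k : v k i \in row i. Proof. by rewrite vE fintype.image_f. Qed.
Let wE k i : w k i = rank (row i) (v k i).
Proof. by rewrite mnmE mxE index_sort_undup ?vE // -vE. Qed.
Let row0 i : 0%N \in row i.
Proof. by have [k <-] := A0 i; apply: fintype.image_f. Qed.

(** Associated primes pass from [I] to its signature without increasing the
    degree of the witness; the degree bound is what controls the v-number. *)
Lemma colon_signature a : is_prime (colon I a) ->
  exists2 b, (mdeg b <= mdeg a)%N & colon J b = colon I a.
Proof.
move=> prI.
have /choice[b_ bP] i : exists j, (j <= a i)%N /\ forall x, x \in row i ->
    ((x <= a i)%N = (rank (row i) x <= j)%N) /\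
    ((x <= (a i).+1)%N -> (rank (row i) x <= j.+1)%N).
  by have [j le_j jP] := rank_lower (a i) (row0 i); exists j.
exists [multinom b_ i | i < n].
  by rewrite !mdegE; apply: leq_sum => i _; rewrite mnmE (bP i).1.
by apply: colon_transfer => // k i; rewrite mnmE wE;
   have [_ /(_ _ (row_mem i k))[]] := bP i.
Qed.

Lemma colon_of_signature b : is_prime (colon J b) ->
  exists a, colon I a = colon J b.
Proof.
move=> prJ; have /choice[a_ aP] i := rank_raise (b i) (row0 i).
exists [multinom a_ i | i < n].
by apply: colon_transfer => // k i; rewrite mnmE wE; have [] := aP i _ (row_mem i k).
Qed.

Lemma Ass_signature : Ass I = Ass J.
Proof.
apply/seteqP; split=> p [prp [a def_p]]; split=> //.
  have [|b _ eq_b] := @colon_signature a; first by rewrite -def_p.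
  by exists b; rewrite eq_b.
have [|b eq_b] := @colon_of_signature a; first by rewrite -def_p.
by exists b; rewrite eq_b.
Qed.

Lemma vnumber_signature : (vnumber J <= vnumber I)%E.
Proof.
apply: le_infimum => _ [a [p [prp _] def_p] <-].
have [|b le_ba eq_b] := @colon_signature a; first by rewrite def_p.
apply: (@le_trans _ _ (mdeg b)%:Z%:E); last by rewrite lee_fin lez_nat.
apply: infimum_le; exists b => //; exists p; last by rewrite eq_b.
by split=> //; exists b; rewrite eq_b.
Qed.

(** The only entries of rank 0 are the zeros, so [v k] and [w k] have the same
    support, and the same primes contain both ideals. *)
Lemma ht_signature : ht I = ht J.
Proof.
congr (infimum _ (_ @` _)); apply/funext => p; apply/propext.
have eq0 k i : (w k i == 0%N) = (v k i == 0%N).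
  have [j] := rank_lower 0 (row0 i); rewrite leqn0 => /eqP-> /(_ _ (row_mem i k))[].
  by rewrite wE -!leqn0 => ->.
split=> -[prp /(prime_mideal _ prp) sub_p]; split=> //.
  apply/(prime_mideal _ prp) => _ [k _ <-].
  by have [i vi pi] := sub_p (v k) (ex_intro2 _ _ k Logic.I erefl);
     exists i; rewrite ?eq0.
apply/(prime_mideal _ prp) => _ [k _ <-].
by have [i wi pi] := sub_p (w k) (ex_intro2 _ _ k Logic.I erefl);
     exists i; rewrite -?eq0.
Qed.

End Signature.

Lemma mideal_incidence (K : fieldType) n (I : set {mpoly K[n]}) :
  monomial_ideal I -> mideal (range (col_mnm (incidence I))) = I.
Proof.
move=> /mingensP[genI _]; rewrite -[RHS]genI; congr (mideal _).
have colE j : col_mnm (incidence I) j = nth 0%MM (mingens I) j.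
  by apply/mnmP => i; rewrite mnmE mxE.
apply/seteqP; split=> [_ [j _ <-]|m mG]; first by rewrite /= colE mem_nth.
by exists (Ordinal (etrans (index_mem m (mingens I)) mG)) => //; rewrite colE nth_index.
Qed.

Theorem theorem3p1 (K : fieldType) (n : nat) (I : set {mpoly K[n]}) :
  monomial_ideal I ->
  (2%:Z%:E <= ht I)%E ->
  [/\ Ass I = Ass (signature I),
      (vnumber (signature I) <= vnumber I)%E
    & unmixed I <-> unmixed (signature I)].
Proof.
move=> /mideal_incidence defI ht2.
have A0 i : exists j, incidence I i j = 0%N.
  rewrite -{1}defI in ht2.
  by have [_ [j _ <-]] := ht_ge2_coprime i ht2; rewrite mnmE; exists j.
have := ht_signature K A0; have := vnumber_signature K A0.
have := Ass_signature K A0; rewrite /signature defI => eqAss le_v eq_ht.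
by split=> //; rewrite /unmixed eqAss eq_ht.
Qed.
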